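(* Let $G=(V,E,\omega,\mu)$ be an infinite, locally finite, connected weighted graph, let $p>1$, and let $\psi:V\to[0,\infty)$ be bounded and not identically zero. Assume $D_\mu<\infty$, $D_\omega<\infty$, $\omega_{\min}>0$ and $\inf_V\mu>0$. Assume that $G$ satisfies the condition $CDE'(n,0)$ for some $n>0$, and that there exist positive constants $c_0,m,r_0$ such that $\mathcal V(x,r)\le c_0r^m$ for all $x\in V$ and $r\ge r_0$. If there exists $\bar x\in V$ such that $\liminf_{d(\bar x,x)\to\infty}\psi(x)>0$, then the life span $T_\lambda$ of the solution of $u_t=\Delta u+u^p$ on $V$ with $u(x,0)=\lambda\psi(x)$ satisfies $T_\lambda<\infty$ for every $\lambda>0$.
   Context: Weighted graph: $V$ is the vertex set, $E$ the edge set, $y\sim x$ means $xy\in E$; $\omega:V\times V\to[0,\infty)$ satisfies $\omega_{xy}=\omega_{yx}$ and $\omega_{xy}>0$ iff $x\sim y$; $\mu:V\to(0,\infty)$. Locally finite means every vertex has finitely many neighbours. Graphs have no loops and no multiple edges. $\omega_{\min}=\inf_{x\sim y}\omega_{xy}$, $\mu_{\max}=\sup_V\mu$, $D_\omega=\mu_{\max}/\omega_{\min}$, $D_\mu=\sup_{x\in V}\frac1{\mu(x)}\sum_{y\sim x}\omega_{xy}$. The distance $d(x,y)$ is the smallest number of edges of a path from $x$ to $y$; $B_x^r=\{y\in V:d(x,y)\le r\}$; $\mathcal V(x,r)=\sum_{y\in B_x^r}\mu(y)$. The Laplacian is $\Delta u(x)=\frac1{\mu(x)}\sum_{y\sim x}\omega_{xy}(u(y)-u(x))$.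 Curvature condition: for $f,g:V\to\mathbb R$ put $$\Gamma(f,g)(x)=\frac1{2\mu(x)}\sum_{y\sim x}\omega_{xy}(f(y)-f(x))(g(y)-g(x)),$$ $$\Gamma_2(f,g)=\tfrac12\big(\Delta\Gamma(f,g)-\Gamma(f,\Delta g)-\Gamma(\Delta f,g)\big),$$ $\Gamma(f)=\Gamma(f,f)$, $\Gamma_2(f)=\Gamma_2(f,f)$. $G$ satisfies $CDE'(n,K)$ if for every $x\in V$ and every $f:V\to(0,\infty)$, $$\Gamma_2(f)(x)-\Gamma\Big(f,\frac{\Gamma(f)}{f}\Big)(x)\ge\frac1n\big[f(x)(\Delta\log f)(x)\big]^2+K\,\Gamma(f)(x).$$ Solution: a solution in $[0,T)$ of the problem $u_t=\Delta u+u^p$ in $V\times(0,T)$, $u(x,0)=\lambda\psi(x)$ on $V$, is a function $u:V\times[0,T)\to[0,\infty)$ satisfying the problem such that for each $x\in V$ the function $u(x,\cdot)$ is continuous on $[0,T)$ and $C^1$ on $(0,T)$, and such that $u$ is bounded on $V\times[0,T']$ for every $0<T'<T$. (A unique local solution exists.) The life span is $T_\lambda=\sup\{T>0:\ \text{the problem has a solution in }[0,T)\}\in(0,\infty]$. *)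

(* Defs.v *)
From HB Require Import structures.
From mathcomp Require Import all_boot all_order all_algebra.
From mathcomp Require Import all_classical all_reals all_analysis.
Import Order.TTheory GRing.Theory Num.Theory.
Import numFieldNormedType.Exports.

Set Implicit Arguments.
Unset Strict Implicit.
Unset Printing Implicit Defensive.

Local Open Scope classical_set_scope.
Local Open Scope ring_scope.

Record weighted_graph (R : realType) (V : choiceType) := WeightedGraph {
  edge : rel V ;
  weight : V -> V -> R ;
  mass : V -> R ;
  edge_irrefl : irreflexive edge ;
  weight_sym : forall x y, weight x y = weight y x ;
  weight_ge0 : forall x y, 0 <= weight x y ;
  weight_gt0 : forall x y, (0 < weight x y) = edge x y ;
  mass_gt0 : forall x, 0 < mass x }.

Section Graph.
Context {R : realType} {V : choiceType} (G : weighted_graph R V).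
Implicit Types (x y : V) (f g : V -> R).

Definition neighbours x : set V := [set y | edge G x y].

Definition locally_finite : Prop := forall x, finite_set (neighbours x).

(* [n] is the number of edges of some path from [x] to [y]. *)
Definition path_length x y (n : nat) : Prop :=
  exists s : seq V, [/\ path (edge G) x s, last x s = y & size s = n].

Definition connected_graph : Prop := forall x y, exists n, path_length x y n.

(* The default value 0 is only taken when no path joins [x] to [y]. *)
Definition dist x y : nat :=
  xget 0%N [set n | path_length x y n /\
                    forall k, path_length x y k -> (n <= k)%N].

Definition gball x (r : R) : set V := [set y | (dist x y)%:R <= r].

(* [\sum_(y \in A)] is a finitely supported sum (0 if the support is infinite);
   in a connected locally finite graph the balls and the neighbourhoods are
   finite, so all the sums below are ordinary finite sums. *)
Definition volume x (r : R) : R := \sum_(y \in gball x r) mass G y.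

Definition omega_min : \bar R :=
  ereal_inf [set (weight G e.1 e.2)%:E | e in [set e : V * V | edge G e.1 e.2]].

Definition mu_min : \bar R := ereal_inf [set (mass G x)%:E | x in [set: V]].

Definition mu_max : \bar R := ereal_sup [set (mass G x)%:E | x in [set: V]].

(* In [\bar R], [0^-1 = +oo]. *)
Definition D_omega : \bar R := (mu_max * omega_min^-1)%E.

Definition D_mu : \bar R :=
  ereal_sup [set ((mass G x)^-1 * \sum_(y \in neighbours x) weight G x y)%:E
            | x in [set: V]].

Definition laplacian f x : R :=
  (mass G x)^-1 * \sum_(y \in neighbours x) weight G x y * (f y - f x).

Definition Gamma f g x : R :=
  (2 * mass G x)^-1 *
  \sum_(y \in neighbours x) weight G x y * (f y - f x) * (g y - g x).

Definition Gamma2 f g x : R :=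
  2^-1 * (laplacian (Gamma f g) x - Gamma f (laplacian g) x
          - Gamma (laplacian f) g x).

Definition CDE' (n K : R) : Prop :=
  forall x f, (forall y, 0 < f y) ->
    Gamma2 f f x - Gamma f (fun y => Gamma f f y / f y) x >=
    n^-1 * (f x * laplacian (fun y => ln (f y)) x) ^+ 2 + K * Gamma f f x.

(* [u] is a total function of time; only its values on [0, T) matter. *)
Record is_solution (p : R) (u0 : V -> R) (T : R) (u : V -> R -> R) : Prop :=
  IsSolution {
    sol_ge0 : forall x (t : R), 0 <= t < T -> 0 <= u x t ;
    sol_cont : forall x, {within `[0, T[, continuous (u x)} ;
    sol_derivable : forall x (t : R), 0 < t < T -> derivable (u x) t 1 ;
    sol_C1 : forall x, {within `]0, T[, continuous derive1 (u x)} ;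
    sol_bounded : forall T' : R, 0 < T' < T ->
      exists M : R, forall x (t : R), 0 <= t <= T' -> `|u x t| <= M ;
    sol_eq : forall x (t : R), 0 < t < T ->
      derive1 (u x) t = laplacian (u^~ t) x + u x t `^ p ;
    sol_init : forall x, u x 0 = u0 x }.

Definition life_span (p : R) (u0 : V -> R) : \bar R :=
  ereal_sup [set T%:E | T in
    [set T : R | 0 < T /\ exists u, is_solution p u0 T u]].

(* The filter of the neighbourhoods of infinity, [dist x0 x --> +oo]. *)
Definition dist_infty x0 : set_system V :=
  filter_from [set: nat] (fun N => [set x | (N <= dist x0 x)%N]).

(* [limf_einf] asks for a [filteredType], which a bare [choiceType] is not; its
   value does not depend on the filtered structure of the domain, for which
   [principal_filter_type] provides the discrete one. *)
Definition liminf_dist x0 f : \bar R :=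
  limf_einf (EFin \o f : principal_filter_type V -> \bar R) (dist_infty x0).

End Graph.

(* Main.v *)
Require Import Defs.
From mathcomp Require Import all_boot all_order all_algebra.
From mathcomp Require Import all_classical all_reals all_analysis.
From mathcomp Require Import ring lra.
Import Order.TTheory GRing.Theory Num.Theory.
Import numFieldNormedType.Exports.
Local Open Scope classical_set_scope.
Local Open Scope ring_scope.

(** Far away from [x0] the initial datum is at least some [c > 0], and the
constant datum [c] produces the solution [v(t) = q(t)^(-1/(p-1))] with
[q(t) = c^(1-p) - (p-1) t], which blows up at [T* = c^(1-p)/(p-1)].  By convexity
of [s |-> s^p], [z = (u - v) / v^p] satisfies [z_t >= laplacian z], and
[z >= -c^(1-p)] everywhere.  Since the vertex degrees are at most [D], the
negative part of [z] decays superexponentially in space: by induction on [k],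
[z >= -c^(1-p) (D t)^k / k!] at distance [>= N + k] from [x0].  Hence a solution
living beyond [T*] is as large as [v] far away, so it is unbounded. *)

(** * Distances, weighted degrees and the Laplacian *)

Section WeightedGraph.
Context {R : realType} {V : choiceType} (G : weighted_graph R V).

(** Connectedness provides some path length, hence a least one, so the default value of [xget] in
    [dist] is never taken. *)
Lemma dist_path_length (x y : V) : connected_graph G ->
  path_length G x y (dist G x y) /\
  forall k, path_length G x y k -> (dist G x y <= k)%N.
Proof.
move=> /(_ x y) [n xyn]; rewrite /dist; case: xgetP => [_ -> //|none].
have ex : exists n, `[< path_length G x y n >] by exists n; exact/asboolP.
have [m /asboolP xym minm] := ex_minnP ex.
by case: (none m); split=> // k xyk; apply: minm; exact/asboolP.
Qed.

Lemma dist_edge (x y z : V) : connected_graph G -> edge G y z ->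
  (dist G x z <= (dist G x y).+1)%N.
Proof.
move=> cG yz; have [[s [xs sy <-]] _] := dist_path_length x y cG.
apply: (dist_path_length x z cG).2; exists (rcons s z).
by rewrite last_rcons size_rcons rcons_path xs sy yz.
Qed.

Lemma finite_path_length (x : V) (n : nat) : locally_finite G ->
  finite_set [set y | path_length G x y n].
Proof.
move=> lfG; elim: n => [|n IHn].
  apply: (sub_finite_set _ (finite_set1 x)) => y [[|? ?] []] //=.
apply: (sub_finite_set (B := \bigcup_(y in [set y | path_length G x y n])
  neighbours G y)).
  move=> z [s []]; case/lastP: s => // s w.
  rewrite rcons_path last_rcons size_rcons => /andP[xs sw] <- [sn].
  by exists (last x s) => //; exists s.
by apply: bigcup_finite => // y _; exact: lfG.
Qed.

(** By local finiteness only finitely many vertices are reached by paths with fewer than [n]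
    edges. *)
Lemma exists_dist_ge (x : V) (n : nat) : infinite_set [set: V] ->
  locally_finite G -> connected_graph G -> exists y, (n <= dist G x y)%N.
Proof.
move=> Vinf lfG cG; apply: contrapT => /forallNP far; apply: Vinf.
apply: (sub_finite_set (B := \bigcup_(k in `I_n)
  [set y | path_length G x y k])).
  move=> y _; have /negP := far y; rewrite -ltnNge => lt_yn.
  by exists (dist G x y) => //; have [] := dist_path_length x y cG.
apply: bigcup_finite => [|k _]; first exact: finite_II.
exact: finite_path_length.
Qed.

(** The quantity whose supremum is [D_mu]; also the coefficient of [- f x] in [laplacian G f x]. *)
Definition degree (x : V) : R :=
  (mass G x)^-1 * \sum_(y \in neighbours G x) weight G x y.

Lemma degree_ge0 (x : V) : 0 <= degree x.
Proof.
apply: mulr_ge0; first by rewrite invr_ge0 ltW // mass_gt0.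
by apply: fsumr_ge0 => y _; exact: weight_ge0.
Qed.

(** The Laplacian increases with the neighbouring values. This carries a lower bound on the
    neighbours over to a differential inequality at [x]. *)
Lemma laplacian_ge (f : V -> R) (b : R) (x : V) : locally_finite G ->
  (forall y, edge G x y -> b <= f y) ->
  degree x * (b - f x) <= laplacian G f x.
Proof.
move=> lfG fb; rewrite /degree /laplacian -mulrA.
apply: ler_wpM2l; first by rewrite invr_ge0 ltW // mass_gt0.
have fin := lfG x.
rewrite mulr_fsuml !fsbig_finite //= !big_seq; apply: ler_sum => y.
rewrite in_fset_set // inE => xy.
by apply: ler_wpM2l; [exact: weight_ge0 | rewrite lerB // fb].
Qed.

Lemma degree_bounded : (D_mu G < +oo)%E ->
  exists2 D : R, 0 <= D & forall x, degree x <= D.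
Proof.
move=> fin; pose D := Num.max 0 (fine (D_mu G)).
exists D => [|x]; first by rewrite le_max lexx.
have le_x : ((degree x)%:E <= D_mu G)%E.
  by apply: ereal_sup_ubound; exists x.
have finD : D_mu G \is a fin_num.
  by rewrite fin_numElt fin andbT (lt_le_trans _ le_x) // ltNyr.
by rewrite le_max -[X in _ || X]lee_fin fineK // le_x orbT.
Qed.

Lemma liminf_dist_gt0 (x : V) (f : V -> R) : (0 < liminf_dist G x f)%E ->
  exists2 c : R, 0 < c &
    exists N : nat, forall y, (N <= dist G x y)%N -> c <= f y.
Proof.
rewrite /liminf_dist limf_einfE => /ereal_sup_gt[_ [A [N _ NA] <-]] /= gt0.
have [e e0 ef] : exists2 e : R, 0 < e &
    (e%:E <= ereal_inf [set (EFin \o f) y | y in A])%E.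
  case: (ereal_inf _) gt0 => [r||] // r0.
    by exists r.
  (* Infimum [+oo]: any positive constant serves. *)
  by exists 1; rewrite ?leey.
exists e => //; exists N => y /NA Ay.
by rewrite -lee_fin; apply: (le_trans ef); apply: ereal_inf_lbound; exists y.
Qed.

End WeightedGraph.

(** * Scalar differential inequalities and convexity *)

Section Calculus.
Context {R : realType}.

Lemma is_derive_within_continuous (f df : R -> R) (A : set R) :
  (forall t, A t -> is_derive t 1 f (df t)) -> {within A, continuous f}.
Proof.
move=> fA; apply: continuous_in_subspaceT => t /set_mem At.
have ft := fA t At.
by apply: differentiable_continuous; apply/derivable1_diffP; exact: ex_derive.
Qed.

(** With the integrating factor [expR (a * t)], the product with [w] is nondecreasing. *)
Lemma linear_ode_ge0 (a b : R) (w dw : R -> R) :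
  {within `[0, b], continuous w} ->
  (forall t, 0 < t < b -> is_derive t 1 w (dw t)) ->
  (forall t, 0 < t < b -> - a * w t <= dw t) ->
  0 <= w 0 -> forall t, 0 <= t <= b -> 0 <= w t.
Proof.
move=> cw w' ge w0 t /andP[t0 tb].
pose e := expR \o (a \*: id).
have e' (s : R) : is_derive s 1 e (a * e s).
  apply: is_derive_eq (is_derive1_comp (is_derive_expR _) _) _.
  by rewrite scaler1 mulrC.
pose g := e * w.
have g' (s : R) : 0 < s < b -> is_derive s 1 g (e s * (dw s + a * w s)).
  move=> sb; have ws := w' s sb; apply: is_derive_eq.
  by rewrite /GRing.scale /=; ring.
have : g 0 <= g t.
  apply: (@ger0_derive1_le_cc _ g 0 b) => //.
  - move=> s; rewrite in_itv => sb; have := g' s sb => gs; exact: ex_derive.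
  - move=> s; rewrite in_itv => sb; have := g' s sb => gs.
    rewrite derive1E derive_val mulr_ge0 ?expR_ge0 //.
    by have := ge s sb; lra.
  - move=> s; apply: continuousM; last exact: cw.
    exact: (is_derive_within_continuous _ _ _ (fun s _ => e' s)).
  - by rewrite in_itv /= lexx (le_trans t0).
  - by rewrite in_itv /= t0.
rewrite /g !fctE /e /= scaler0 expR0 mul1r => /(le_trans w0).
by rewrite pmulr_rge0 // expR_gt0.
Qed.

(** The convex power lies above its tangent at 1; this is Young's inequality for the product of [x]
    and 1. *)
Lemma powR_ge_tangent (p x : R) : 1 < p -> 0 <= x ->
  1 + p * (x - 1) <= x `^ p.
Proof.
move=> p1 x0; have p0 : 0 < p by lra.
have q0 : 0 < p / (p - 1) by rewrite divr_gt0 //; lra.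
have conj : p^-1 + (p / (p - 1))^-1 = 1 by field; lra.
have := conjugate_powR x0 ler01 p0 q0 conj.
rewrite powR1 mulr1 mul1r -(ler_pM2l p0) mulrDr mulrCA divff ?gt_eqF // mulr1.
suff -> : p * (p / (p - 1))^-1 = p - 1 by lra.
by field; lra.
Qed.

End Calculus.

(** * Comparison with the spatially constant solution *)

Section Comparison.
Context {R : realType} {V : choiceType} (G : weighted_graph R V).
Context (p C : R) (p_gt1 : 1 < p) (C_gt0 : 0 < C).

(** For the spatially constant solution [v], [q] is [v^(1-p)]; thus [q^gam = 1/v] and
    [q^(1+gam) = 1/v^p]. *)
Let q (t : R) : R := C - (p - 1) * t.
Let gam : R := (p - 1)^-1.

Let q_derive (t : R) : is_derive t 1 q (1 - p).
Proof.
apply: is_derive_eq.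
by rewrite /GRing.scale /=; lra.
Qed.

Let qpow_derive (t : R) : 0 < q t ->
  is_derive t 1 (fun s => q s `^ (1 + gam)) (- p * q t `^ gam).
Proof.
move=> qt.
have q' := is_derive1_comp (is_derive1_powR (1 + gam) qt) (q_derive t).
apply: is_derive_eq q' _.
rewrite addrAC subrr add0r; move: (q t `^ gam) => X.
by rewrite /gam; field; rewrite subr_eq0 gt_eqF.
Qed.

Let exp_coeff_derive (D : R) (k : nat) (t : R) :
  is_derive t 1 (fun s => exp_coeff (D * s) k.+1) (D * exp_coeff (D * t) k).
Proof.
have -> : (fun s => exp_coeff (D * s) k.+1) =
    (D ^+ k.+1 / k.+1`!%:R) \*: ((@id R) ^+ k.+1).
  by apply/funext => s; rewrite /exp_coeff /= exprMn /GRing.scale /= fctE; ring.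
apply: is_derive_eq.
rewrite /exp_coeff /= exprMn factS natrM exprS /GRing.scale /=.
by field; rewrite nat1r !pnatr_eq0 -lt0n fact_gt0.
Qed.

(* In terms of [z = u q^(p/(p-1)) - q] and [E_k = C (D t)^k / k!] this reads
   [z >= - E_k]; the induction step is [z' + degree x * z >= - D E_k] and
   [E_(k+1)' = D E_k]. *)
Lemma solution_lower_bound (x0 : V) (N : nat) (D T b : R) (u0 : V -> R)
    (u : V -> R -> R) :
  locally_finite G -> connected_graph G ->
  (forall x, degree G x <= D) -> is_solution G p u0 T u ->
  (forall x, (N <= dist G x0 x)%N -> 1 <= u0 x * C `^ gam) ->
  b < T -> 0 < q b ->
  forall k x t, (N + k <= dist G x0 x)%N -> 0 <= t <= b ->
    q t - C * exp_coeff (D * t) k <= u x t * q t `^ (1 + gam).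
Proof.
move=> lfG cG degD sol u0C bT qb.
have p0 : 0 < p - 1 by rewrite subr_gt0.
have q0 t : 0 <= t <= b -> 0 < q t.
  move=> /andP[_ tb]; apply: lt_le_trans qb _.
  by rewrite /q lerD2l lerN2 ler_pM2l.
have inT t : 0 <= t <= b -> 0 <= t < T.
  by move=> /andP[-> tb]; exact: le_lt_trans tb bT.
elim=> [x t _ tb|k IHk x t xN tb].
  (* For [k = 0] the left side is [q t - C], which is nonpositive. *)
  rewrite /exp_coeff /= expr0 fact0 invr1 !mulr1 /q.
  have ut := sol_ge0 sol x (inT t tb).
  have : 0 <= u x t * q t `^ (1 + gam) by rewrite mulr_ge0 ?powR_ge0.
  by case/andP: tb => t0 _; have := mulr_ge0 (ltW p0) t0; rewrite /q; lra.
(* [w] is [z + E_(k+1)], and [dw] below is its derivative by the product rule. *)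
pose w s := u x s * q s `^ (1 + gam) - q s + C * exp_coeff (D * s) k.+1.
suff : 0 <= w t by rewrite /w; lra.
have D0 : 0 <= D by apply: le_trans (degree_ge0 G x) (degD x).
pose dw s := (u x s * (- p * q s `^ gam) + q s `^ (1 + gam) * derive1 (u x) s)
  - (1 - p) + C * (D * exp_coeff (D * s) k).
apply: (@linear_ode_ge0 _ (degree G x) b w dw) => //.
- have cu : {within `[0, b], continuous (u x)}.
    apply: (continuous_subspaceW _ (@sol_cont _ _ _ _ _ _ _ sol x)) => s /=.
    by rewrite !in_itv /=; exact: inT.
  have cQ : {within `[0, b], continuous (fun s => q s `^ (1 + gam))}.
    apply: (is_derive_within_continuous _ _ _ (fun s sb => qpow_derive s _)).
    by apply: q0; move: sb; rewrite /= in_itv.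
  have cq : {within `[0, b], continuous q}.
    exact: (is_derive_within_continuous _ _ _ (fun s _ => q_derive s)).
  have cE : {within `[0, b], continuous (fun s => exp_coeff (D * s) k.+1)}.
    exact: (is_derive_within_continuous _ _ _
      (fun s _ => exp_coeff_derive D k s)).
  move=> s; apply: cvgD; last by apply: cvgMr; exact: cE.
  apply: cvgB; last exact: cq.
  by apply: cvgM; [exact: cu | exact: cQ].
- move=> s /andP[s0 sb].
  have qs : 0 < q s by apply: q0; rewrite !ltW.
  have us : is_derive s 1 (u x) (derive1 (u x) s).
    rewrite derive1E; apply/derivableP; apply: (sol_derivable sol).
    by rewrite s0 (lt_trans sb).
  have Qs := qpow_derive s qs; have q's := q_derive s.
  have Es := exp_coeff_derive D k s.
  exact: is_derive_eq (is_deriveD (is_deriveB (is_deriveM us Qs) q's)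
    (is_deriveZ C Es)) _.
- move=> s /andP[s0 sb].
  have sb' : 0 <= s <= b by rewrite !ltW.
  have qs := q0 s sb'.
  rewrite /dw (sol_eq sol) ?s0 ?(lt_trans sb) //.
  set Q := q s `^ (1 + gam); set h := q s `^ gam.
  have Q0 : 0 < Q by exact: powR_gt0.
  have us := sol_ge0 sol x (inT s sb').
  (* [Q = h^p], because [gam * p = 1 + gam]. *)
  have Qup : Q * u x s `^ p = (u x s * h) `^ p.
    rewrite powRM ?powR_ge0 // mulrC -powRrM; congr (_ * _ `^ _).
    by rewrite /gam; field; rewrite subr_eq0 gt_eqF.
  (* The tangent bound cancels the term [- p * u * h] and the constant [p - 1] in [dw], leaving
     [dw >= Q * laplacian + D * E]. *)
  have := powR_ge_tangent p (u x s * h) p_gt1 (mulr_ge0 us (powR_ge0 _ _)).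
  rewrite -{}Qup => tangent.
  pose E := C * exp_coeff (D * s) k.
  have E0 : 0 <= E by rewrite mulr_ge0 ?exp_coeff_ge0 ?mulr_ge0 // ltW.
  have E'0 : 0 <= C * exp_coeff (D * s) k.+1.
    by rewrite mulr_ge0 ?exp_coeff_ge0 ?mulr_ge0 // ltW.
  (* Neighbours of [x] are at most one step closer to [x0], hence at distance at least [N + k],
     where the induction hypothesis applies. *)
  have : degree G x * ((q s - E) / Q - u x s) <= laplacian G (u^~ s) x.
    apply: laplacian_ge => // y xy; rewrite ler_pdivrMr //; apply: IHk => //.
    rewrite -ltnS -addnS (leq_trans xN) //; apply: dist_edge => //.
    by rewrite -weight_gt0 weight_sym weight_gt0.
  rewrite -(ler_pM2l Q0) mulrCA mulrBr [Q * (_ / _)]mulrCA divff ?gt_eqF //.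
  rewrite mulr1 => lap.
  have := ler_wpM2r E0 (degD x).
  have := mulr_ge0 (degree_ge0 G x) E'0.
  rewrite /w -/Q; move: lap tangent; rewrite /E.
  move: (degree G x) (laplacian _ _ x) (u x s `^ p) (exp_coeff _ k) => d L P e.
  move: (exp_coeff _ k.+1) (u x s) (q s) Q h {Q0} => e' v r S g; lra.
(* At time 0 the term [exp_coeff 0 k.+1] vanishes, and the hypothesis on [u0] gives
   [u0 x * C^(1+gam) >= C]. *)
- have x_far : (N <= dist G x0 x)%N by apply: leq_trans xN; exact: leq_addr.
  have := u0C x x_far; rewrite -(ler_pM2l C_gt0) mulr1.
  rewrite /w /= (sol_init sol) /q !mulr0 subr0 powRD ?(gt_eqF C_gt0) ?implybT //.
  rewrite (powRr1 (ltW C_gt0)) /exp_coeff /= expr0n /= mul0r mulr0 mulrCA; lra.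
Qed.

End Comparison.

Theorem theorem1p2 (R : realType) (V : choiceType) (G : weighted_graph R V)
    (p : R) (psi : V -> R)
    (V_infinite : infinite_set [set: V])
    (G_locally_finite : locally_finite G)
    (G_connected : connected_graph G)
    (p_gt1 : 1 < p)
    (psi_ge0 : forall x, 0 <= psi x)
    (psi_bounded : exists M : R, forall x, psi x <= M)
    (psi_neq0 : exists x, psi x != 0)
    (D_mu_fin : (D_mu G < +oo)%E)
    (D_omega_fin : (D_omega G < +oo)%E)
    (omega_min_gt0 : (0 < omega_min G)%E)
    (mu_min_gt0 : (0 < mu_min G)%E)
    (curvature : exists n : R, 0 < n /\ CDE' G n 0)
    (volume_growth : exists c0 m r0 : R, [/\ 0 < c0, 0 < m, 0 < r0 &
      forall (x : V) (r : R), r0 <= r -> volume G x r <= c0 * r `^ m])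
    (psi_liminf : exists xbar : V, (0 < liminf_dist G xbar psi)%E) :
  forall lambda : R, 0 < lambda ->
    (life_span G p (fun x => (lambda * psi x)%R) < +oo)%E.

Proof.
move=> lambda lambda0.
have [D D0 degD] := degree_bounded G D_mu_fin.
have [x0 /liminf_dist_gt0[c1 c10 [N psi_ge]]] := psi_liminf.
pose c := lambda * c1; have c0 : 0 < c by exact: mulr_gt0.
have p0 : 0 < p - 1 by rewrite subr_gt0.
pose C := c `^ (1 - p); have C0 : 0 < C by exact: powR_gt0.
apply: (@le_lt_trans _ _ (C / (p - 1))%:E); last exact: ltry.
apply: ge_ereal_sup => _ [T [T0 [u sol]] <-].
rewrite lee_fin leNgt; apply/negP => ltT.
have Tstar : 0 < C / (p - 1) < T by rewrite divr_gt0.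
have [M uM] := sol_bounded sol Tstar.
(* The time [b] below is when [v] reaches [|M| + c + 1], so [h = 1/v(b)] and [q = v(b)^(1-p)]. The
   summand [c] ensures [q <= C], that is [b >= 0]. *)
pose h := (`|M| + c + 1)^-1.
have M0 := normr_ge0 M.
have h0 : 0 < h by rewrite invr_gt0; lra.
pose q := h `^ (p - 1).
have q0 : 0 < q by exact: powR_gt0.
have qC : q <= C.
  have -> : C = c^-1 `^ (p - 1).
    by rewrite /C -powR_inv1 ?(ltW c0) // -powRrM mulN1r opprB.
  apply: ge0_ler_powR; rewrite ?nnegrE ?(ltW h0) ?(ltW p0) ?invr_ge0 ?(ltW c0) //.
  by rewrite /h lef_pV2 ?posrE //; lra.
pose b := (C - q) / (p - 1).
have bE : C - (p - 1) * b = q by rewrite /b mulrC divfK ?gt_eqF //; lra.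
have b0 : 0 <= b by apply: divr_ge0; [rewrite subr_ge0 | exact: ltW].
have bT : b <= C / (p - 1) by rewrite ler_pM2r ?invr_gt0 //; lra.
(* [eps] equals [q - |M| * (q * h)], the margin by which [v(b)] exceeds [|M|], scaled by [q * h]. *)
pose eps := q * (h * (c + 1)).
have eps0 : 0 < eps by rewrite !mulr_gt0 //; lra.
(* Since [(D b)^k / k!] tends to 0, some [k] makes the error [E_k] at time [b] smaller than
   [eps]. *)
have [k _ /(_ k (leqnn k)) /=] :=
  (cvgrPdist_lt _ _).1 (cvg_exp_coeff (D * b)) (eps / C) (divr_gt0 eps0 C0).
rewrite sub0r normrN ger0_norm; last exact/exp_coeff_ge0/mulr_ge0.
move=> small.
have [x x_far] := exists_dist_ge G x0 (N + k)
  V_infinite G_locally_finite G_connected.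
have := @solution_lower_bound R V G p C p_gt1 C0 x0 N D T b _ u
  G_locally_finite G_connected degD sol _ _ _ k x b x_far.
rewrite bE b0 lexx => /(_ _ (le_lt_trans bT ltT) q0 isT).
have -> : q `^ (1 + (p - 1)^-1) = q * h.
  rewrite powRD ?(gt_eqF q0) ?implybT // (powRr1 (ltW q0)).
  by rewrite /q -powRrM divff ?gt_eqF // (powRr1 (ltW h0)).
have ub : u x b <= `|M|.
  apply: le_trans (ler_norm _) _; apply: le_trans (uM x b _) (ler_norm _).
  exact/andP.
move=> lower.
have {lower}: q - C * exp_coeff (D * b) k <= u x b * (q * h).
  apply: lower => y /psi_ge psi_y.
  (* Here [C^gam = 1/c], so the condition on the datum reads [c <= lambda * psi y]. *)
  rewrite /C -powRrM -(opprB p) mulNr divff ?gt_eqF // powR_inv1 ?(ltW c0) //.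
  by rewrite ler_pdivlMr // mul1r ler_pM2l.
move=> lower; move: small; rewrite ltr_pdivlMr // mulrC => small.
(* Contradiction: [q - eps < u x b * (q * h) <= |M| * (q * h) = q - eps]. *)
have := ler_wpM2r (ltW (mulr_gt0 q0 h0)) ub.
have hE : h * (`|M| + c + 1) = 1 by rewrite mulVf // gt_eqF //; lra.
have qE : q = eps + `|M| * (q * h) by rewrite -[LHS]mulr1 -hE /eps; ring.
move: lower small; rewrite {1}qE; lra.
Qed.
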